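(* Let $\alpha:(0,\infty)\to(0,\infty)$ be a $C^2$ function such that $1/\alpha(\rho)$ is a concave function of $\rho>0$, and let the specific internal energy be a convex function of $(v,\eta)$, where $v=1/\rho$. Then the energy $$E(\rho,\mathbf{m},s,\mathbf{j})=\frac{1}{2\rho}\|\mathbf{m}\|^2+\rho\,\varepsilon(\rho,s/\rho)+\frac12\alpha(\rho)\|\mathbf{j}\|^2$$ is a convex function of $(\rho,\mathbf{m},s,\mathbf{j})$ (with $\rho>0$, $\mathbf{m},\mathbf{j}\in\mathbb{R}^d$, $s\in\mathbb{R}$).
   Context: $\rho$ is the density, $\mathbf{m}=\rho\mathbf{u}$ the momentum, $s=\rho\eta$ the entropy per unit volume, $\eta$ the specific entropy, $\mathbf{j}$ a vector field. $\varepsilon(\rho,\eta)$ is the ($C^2$) specific internal energy; convexity in $(v,\eta)$ means that $(v,\eta)\mapsto\varepsilon(1/v,\eta)$ is convex on $\{v>0\}\times\mathbb{R}$. *)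

(* Defs.v *)
From HB Require Import structures.
From mathcomp Require Import all_boot all_order all_algebra.
From mathcomp Require Import interval_inference classical_sets reals topology.
From mathcomp Require Import normedtype derive convex.

Set Implicit Arguments.
Unset Strict Implicit.
Unset Printing Implicit Defensive.

Import Order.TTheory GRing.Theory Num.Theory.
Import numFieldNormedType.Exports.

Local Open Scope classical_set_scope.
Local Open Scope ring_scope.
Local Open Scope convex_scope.

(* Class C^k on an open subset D of a finite-dimensional space V: Frechet
   differentiability at each point of D, all directional derivatives being of
   class C^(k-1) on D.  The values of f outside of D are irrelevant. *)
Fixpoint Ck_on (R : realType) (V : normedModType R) (k : nat) (D : set V)
    (f : V -> R) : Prop :=
  if k is k'.+1 then
    (forall x, D x -> differentiable f x) /\
    (forall u : V, Ck_on k' D ('D_u f))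
  else forall x, D x -> {for x, continuous f}.

(* Same shape as [convex_function], with the inequality reversed. *)
Definition concave_function (R : numFieldType) (E : lmodType R)
    (E' := convex_lmodType E) (D : set E') (f : E' -> R^o) :=
  forall t : {i01 R},
    {in D &, forall x y : E', f x <| t |> f y <= f (x <| t |> y)}.

(* The library norm on row vectors is the sup norm. *)
Definition sqr_enorm (R : realType) (d : nat) (x : 'rV[R]_d) : R :=
  \sum_(i < d) x 0 i ^+ 2.

Definition energy (R : realType) (d : nat) (alpha : R -> R) (eps : R -> R -> R)
    (rho : R) (m : 'rV[R]_d) (s : R) (j : 'rV[R]_d) : R :=
  (2 * rho)^-1 * sqr_enorm m + rho * eps rho (s / rho)
    + 2^-1 * alpha rho * sqr_enorm j.

(* Main.v *)
Require Import Defs.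
From mathcomp Require Import all_boot all_order all_algebra.
From mathcomp Require Import unstable interval_inference classical_sets reals topology.
From mathcomp Require Import normedtype derive convex.
From mathcomp Require Import ring lra.

Set Implicit Arguments.
Unset Strict Implicit.
Unset Printing Implicit Defensive.

Import Order.TTheory GRing.Theory Num.Theory.
Import numFieldNormedType.Exports.

Local Open Scope classical_set_scope.
Local Open Scope ring_scope.

(** The energy is a sum of three terms, each of which is convex on its own.

The kinetic term and the [j]-term have the same shape: the function
[(c, x) |-> `|x|^2 / c] is jointly convex on [c > 0] and nonincreasing in [c].
The kinetic term takes [c = rho].  The other one takes [c = 1 / alpha rho],
and monotonicity in [c] is what turns concavity of [1 / alpha] into convexity
of [alpha rho * `|j|^2].  Joint convexity and monotonicity are used together,
as the single inequality [quad_over_lin_le] (a two-term Cauchy-Schwarz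
inequality), summed over coordinates in [sqr_enorm_over_lin_le].

The internal energy [rho * eps rho (s / rho)] is the perspective
[rho * g (1 / rho, s / rho)] of the convex function
[g (v, eta) = eps (1 / v) eta].  Mixing [(a, r)] and [(b, s)] with weights
[p] and [q] amounts to mixing [(1 / a, r / a)] and [(1 / b, s / b)] with the
mass fractions [p * a / c] and [q * b / c], where [c = p * a + q * b]; this is
[internal_energy_convex]. *)

(** Multiplying the right-hand side by [p * a + q * b] and subtracting
[(p * x + q * y) ^+ 2] leaves [p * q * a * b * (x / a - y / b) ^+ 2].  The
denominator on the left is allowed to be larger than [p * a + q * b] so that
the values of a concave function can be used as denominators. *)
Lemma quad_over_lin_le (F : realFieldType) (p q a b c x y : F) :
  0 <= p -> 0 <= q -> 0 < a -> 0 < b -> 0 < c -> p * a + q * b <= c ->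
  (p * x + q * y) ^+ 2 / c <= p * (x ^+ 2 / a) + q * (y ^+ 2 / b).
Proof.
move=> p0 q0 a0 b0 c0 le_c; rewrite ler_pdivrMr//.
set S := p * (x ^+ 2 / a) + q * (y ^+ 2 / b).
have S0 : 0 <= S.
  by rewrite addr_ge0// mulr_ge0// divr_ge0 ?sqr_ge0// ltW.
apply: le_trans (ler_wpM2l S0 le_c); rewrite -subr_ge0.
have -> : S * (p * a + q * b) - (p * x + q * y) ^+ 2 =
    p * q * a * b * (x / a - y / b) ^+ 2.
  by rewrite /S; field; rewrite !gt_eqF.
by rewrite mulr_ge0 ?sqr_ge0// !mulr_ge0// ltW.
Qed.

Lemma sqr_enorm_over_lin_le (R : realType) (d : nat) (p q a b c : R)
    (x y : 'rV[R]_d) :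
  0 <= p -> 0 <= q -> 0 < a -> 0 < b -> 0 < c -> p * a + q * b <= c ->
  sqr_enorm (p *: x + q *: y) / c <=
    p * (sqr_enorm x / a) + q * (sqr_enorm y / b).
Proof.
move=> p0 q0 a0 b0 c0 le_c; rewrite /sqr_enorm !mulr_suml !mulr_sumr.
rewrite -big_split /=; apply: ler_sum => i _; rewrite !mxE.
exact: quad_over_lin_le.
Qed.

(** The weights [p] and [q] of the mixture become the mass fractions
[p * a / c] and [q * b / c] in the variables (specific volume, specific
entropy), where [c] is the mixed density.  The mixed specific volume is
[1 / c] because the mass fractions absorb the factors [a] and [b]. *)
Lemma internal_energy_convex (R : realType) (eps : R -> R -> R)
    (p q a b r s : R) :
  convex_function (E := (R^o * R^o)%type) [set v : R * R | 0 < v.1]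
    (fun v : R * R => eps (1 / v.1) v.2) ->
  0 <= p -> 0 <= q -> p + q = 1 -> 0 < a -> 0 < b ->
  (p * a + q * b) * eps (p * a + q * b) ((p * r + q * s) / (p * a + q * b)) <=
    p * (a * eps a (r / a)) + q * (b * eps b (s / b)).
Proof.
move=> cvx p0 q0 pq1 a0 b0; set c := p * a + q * b.
have c0 : 0 < c.
  have [p_le0|p_gt0] := leP p 0.
    by rewrite ltr_wpDl ?mulr_ge0 ?(ltW a0)// mulr_gt0//; lra.
  by rewrite ltr_pwDl ?mulr_gt0// mulr_ge0// ltW.
have u0 : 0 <= p * a / c by rewrite divr_ge0 ?mulr_ge0 ?(ltW a0) ?(ltW c0).
have w0 : 0 <= q * b / c by rewrite divr_ge0 ?mulr_ge0 ?(ltW b0) ?(ltW c0).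
have uE : 1 - p * a / c = q * b / c by rewrite /c; field; rewrite gt_eqF.
have u1 : p * a / c <= 1 by rewrite -subr_ge0 uE.
have ain : (1 / a, r / a) \in [set v : R * R | 0 < v.1].
  by rewrite inE /= divr_gt0.
have bin : (1 / b, s / b) \in [set v : R * R | 0 < v.1].
  by rewrite inE /= divr_gt0.
have an0 : a != 0 by rewrite gt_eqF.
have bn0 : b != 0 by rewrite gt_eqF.
have cn0 : c != 0 by rewrite gt_eqF.
have := cvx (Itv01 u0 u1) (1 / a, r / a) (1 / b, s / b) ain bin.
rewrite [X in _ <= X]convRE /= /onem uE.
have -> : (p * a / c) *: (1 / a : R^o) + (q * b / c) *: (1 / b : R^o) = 1 / c.
  rewrite /GRing.scale /=.
  (* The normalization [p + q = 1] is needed here: the left-hand side is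
     [(p + q) / c]. *)
  have -> : 1 / c = (p + q) / c by rewrite pq1.
  by field; rewrite an0 bn0 cn0.
have -> : (p * a / c) *: (r / a : R^o) + (q * b / c) *: (s / b : R^o) =
    (p * r + q * s) / c.
  by rewrite /GRing.scale /=; field; rewrite an0 bn0 cn0.
rewrite !div1r !invrK => /(ler_wpM2l (ltW c0)) /le_trans; apply.
by rewrite le_eqVlt; apply/orP; left; apply/eqP; field.
Qed.

Theorem mainTheorem2 (R : realType) (d : nat)
    (alpha : R -> R) (eps : R -> R -> R)
    (alpha_gt0 : forall rho : R, 0 < rho -> 0 < alpha rho)
    (alpha_C2 : Ck_on 2 [set rho : R | 0 < rho] alpha)
    (alpha_concave :
       concave_function (E := R^o) [set rho : R | 0 < rho]
         (fun rho : R => 1 / alpha rho))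
    (eps_C2 : Ck_on 2 [set p : R * R | 0 < p.1]
       (fun p : R * R => eps p.1 p.2))
    (eps_convex :
       convex_function (E := (R^o * R^o)%type) [set p : R * R | 0 < p.1]
         (fun p : R * R => eps (1 / p.1) p.2)) :
  convex_function (E := (R^o * 'rV[R]_d * R^o * 'rV[R]_d)%type)
    [set x : R * 'rV[R]_d * R * 'rV[R]_d | 0 < x.1.1.1]
    (fun x : R * 'rV[R]_d * R * 'rV[R]_d =>
       let: (rho, m, s, j) := x in energy alpha eps rho m s j).
Proof.
move=> t [[[a m] r] j] [[[b n] s] k]; rewrite !inE /= => a0 b0.
rewrite [X in _ <= X]convRE.
have alpha_t : t%:num * (1 / alpha a) + (t%:num).~ * (1 / alpha b) <=
    1 / alpha (t%:num * a + (t%:num).~ * b).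
  by apply: (alpha_concave t a b); rewrite inE.
have c0 : 0 < t%:num * a + (t%:num).~ * b := convR_gt0 t a0 b0.
have p0 : 0 <= t%:num by exact: ge0.
have q0 : 0 <= (t%:num).~ by exact: onem_ge0 (le1 t).
have pq1 : t%:num + (t%:num).~ = 1 by exact: add_onemK.
(* Convex combinations in the product space are computed componentwise. *)
rewrite -[X in X <= _]/(energy alpha eps (t%:num * a + (t%:num).~ * b)
  (t%:num *: m + (t%:num).~ *: n) (t%:num * r + (t%:num).~ * s)
  (t%:num *: j + (t%:num).~ *: k)).
move: (t%:num) (t%:num).~ p0 q0 pq1 alpha_t c0 => p q p0 q0 pq1 alpha_t c0.
(* The denominators are the densities themselves, mixed affinely. *)
have kin := sqr_enorm_over_lin_le m n p0 q0 a0 b0 c0 (lexx _).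
have int := internal_energy_convex r s eps_convex p0 q0 pq1 a0 b0.
(* The denominators are the values of [1 / alpha]; by concavity, the value at
   the mixed density is at least the mixture of the values. *)
have mag : sqr_enorm (p *: j + q *: k) * alpha (p * a + q * b) <=
    p * (sqr_enorm j * alpha a) + q * (sqr_enorm k * alpha b).
  have inv_gt0 z : 0 < z -> 0 < 1 / alpha z.
    by move=> z0; rewrite divr_gt0 ?alpha_gt0.
  have := sqr_enorm_over_lin_le j k p0 q0 (inv_gt0 _ a0) (inv_gt0 _ b0)
    (inv_gt0 _ c0) alpha_t.
  by rewrite !div1r !invrK.
by rewrite /energy !invfM; lra.
Qed.
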